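(* Let $\Theta^\star\subseteq\Omega$ be a symmetric set (i.e., $u\in\Theta^\star$ implies $-u\in\Theta^\star$), and let $\mathbb{D}(\cdot)$ be a non-stochastic map defined on $\Theta^\star$ that is even (i.e., $\mathbb{D}(-u)=\mathbb{D}(u)$ for all $u\in\Theta^\star$). Let $\mathbb{X}(u)=0$ for all $u\in\Theta^\star$ and $\mathbb{X}(u)=+\infty$ for all $u\notin\Theta^\star$. Additionally, let $u\mapsto\mathbb{S}(u)$ be a mean zero even stochastic process. Suppose that $u\mapsto \mathbb{D}(u)+\mathbb{S}(u)+\mathbb{X}(u)$ almost surely has a unique minimizer $W=\arg\min_{u\in\Omega}\,\mathbb{D}(u)+\mathbb{S}(u)+\mathbb{X}(u)$. Then $W$ is a symmetric (around zero) random variable, i.e., $W\overset{d}{=}-W$.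
   Context: $\Omega$ is a location-scale invariant space (e.g. $\mathbb{R}^p$). A stochastic process $u\mapsto\mathbb{S}(u)$ is called even if the processes $u\mapsto\mathbb{S}(u)$ and $u\mapsto\mathbb{S}(-u)$ share the same law. $\overset{d}{=}$ denotes equality in distribution.
   Formalization: The law of S is taken on a path space whose σ-algebra makes the argmin a measurable functional on a set of paths containing S almost surely; with finite-dimensional laws only the claim fails (S(u) = −1 if u = U, else 0, with U uniform on [1,2], D = 0, Θ* = R). *)

(* Defs.v *)
From HB Require Import structures.
From mathcomp Require Import all_boot all_order all_algebra.
From mathcomp Require Import all_classical all_reals all_analysis.

Set Implicit Arguments.
Unset Strict Implicit.
Unset Printing Implicit Defensive.

Import Order.TTheory GRing.Theory Num.Theory.
Import numFieldNormedType.Exports.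

Local Open Scope classical_set_scope.
Local Open Scope ring_scope.

Definition generated_space (R : realType) (E : lmodType R)
  (G : set (set E)) : Type := E.

(* Sigma-algebras generated in the library live on a pointed type; the point
   of a vector space is its origin. *)
HB.instance Definition _ (R : realType) (E : lmodType R) (G : set (set E)) :=
  Choice.copy (generated_space G) E.

HB.instance Definition _ (R : realType) (E : lmodType R) (G : set (set E)) :=
  isPointed.Build (generated_space G) (0 : E).

HB.instance Definition _ (R : realType) (E : lmodType R) (G : set (set E)) :=
  Measurable.copy (generated_space G)
    (@g_sigma_algebraType (generated_space G) G).

(* The real vector space E, with the sigma-algebra generated by G, is a
   location-scale invariant space: every change of location and scale is
   measurable.  Example: R^p, with G the open sets. *)
Definition location_scale_invariant (R : realType) (E : lmodType R)
    (G : set (set E)) : Prop :=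
  forall (a : R) (b : E),
    measurable_fun [set: generated_space G]
      (fun u : generated_space G => (a *: (u : E) + b) : generated_space G).

(* Equality is only asked for on measurable sets: a measure is a total function
   on [set T] whose values on the other sets are unspecified. *)
Definition eq_in_law (d d' : measure_display) (T : measurableType d)
    (U : measurableType d') (R : realType) (P : probability T R)
    (X Y : T -> U) : Prop :=
  [/\ measurable_fun [set: T] X, measurable_fun [set: T] Y
    & forall A : set U, measurable A -> pushforward P X A = pushforward P Y A].

(* A process is a random element of the space of all paths [E -> R], given the
   sigma-algebra generated by F, and its law is its image measure there.  F is a
   parameter because the product sigma-algebra alone, i.e. the finite-dimensional
   laws, does not determine the law of a minimizer over an uncountable index
   set: if U is uniform on [1, 2], then S(u) = - 1_(u = U) has the same
   finite-dimensional laws as S(- u), but is minimized at U.  To work with a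
   smaller set of paths, such as the continuous functions, let F consist of the
   cylinder sets and of that set. *)
Definition measurable_evaluations (E : Type) (R : realType)
    (F : set (set (E -> R))) : Prop :=
  forall u : E,
    measurable_fun [set: g_sigma_algebraType F] (fun f : g_sigma_algebraType F => f u : R).

Definition even_process (d : measure_display) (T : measurableType d)
    (R : realType) (P : probability T R) (E : zmodType)
    (F : set (set (E -> R))) (S : T -> g_sigma_algebraType F) : Prop :=
  eq_in_law P S (fun w => (fun u => S w (- u)) : g_sigma_algebraType F).

Definition mean_zero (d : measure_display) (T : measurableType d)
    (R : realType) (P : probability T R) (E : Type) (S : T -> E -> R) : Prop :=
  forall u : E, P.-integrable [set: T] (fun w => (S w u)%:E) /\
    ('E_P[fun w => S w u] = 0)%E.

Definition unique_minimizer (E : Type) (R : realType) (h : E -> \bar R)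
    (u : E) : Prop :=
  (forall v, (h u <= h v)%E) /\
  (forall u', (forall v, (h u' <= h v)%E) -> u' = u).

Definition criterion (E : Type) (R : realType) (D : E -> R) (X : E -> \bar R)
    (f : E -> R) (u : E) : \bar R :=
  ((D u)%:E + (f u)%:E + X u)%E.

(* On the set C of paths, the functional f |-> argmin (D + f + X), defined where
   the minimizer is unique, is measurable. *)
Definition argmin_measurable_on (R : realType) (E : lmodType R)
    (G : set (set E)) (F : set (set (E -> R))) (C : set (g_sigma_algebraType F))
    (D : E -> R) (X : E -> \bar R) : Prop :=
  forall B : set (generated_space G), measurable B ->
    measurable (C `&` [set f : g_sigma_algebraType F |
      exists2 u, B u & unique_minimizer (criterion D X f) u]).

(* Main.v *)
(** The criterion of the reflected path u |-> f (- u) is the reflection of the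
criterion of f, so the argmin functional is odd on paths.  As W is the value of
this functional at S, and -W its value at the reflection of S, the equality of
the laws of the two paths carries over to W and -W. *)

Require Import Defs.
From HB Require Import structures.
From mathcomp Require Import all_boot all_order all_algebra.
From mathcomp Require Import all_classical all_reals all_analysis.

Set Implicit Arguments.
Unset Strict Implicit.
Unset Printing Implicit Defensive.

Import Order.TTheory GRing.Theory Num.Theory.
Import numFieldNormedType.Exports.

Local Open Scope classical_set_scope.
Local Open Scope ring_scope.

(** Each set splits into the common part and a difference, and both differences are null. No measure
    is subtracted, so [mu] may be infinite. *)
Lemma measure_ae_eq_set (d : measure_display) (T : measurableType d)
    (R : realType) (mu : {measure set T -> \bar R}) (A B : set T) :
  measurable A -> measurable B -> {ae mu, forall w, A w <-> B w} ->
  mu A = mu B.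
Proof.
move=> mA mB AB.
have diff0 (A' B' : set T) : measurable A' -> measurable B' ->
    {ae mu, forall w, A' w <-> B' w} -> mu (A' `\` B') = 0%E.
  move=> mA' mB' AB'; apply: measure_negligible; first exact: measurableD.
  by apply: negligibleS AB' => w /= [A'w nB'w] AB'w; apply/nB'w/AB'w.
have BA : {ae mu, forall w, B w <-> A w} by apply: filterS AB => w [].
rewrite (measureDI mu mA mB) (measureDI mu mB mA) (setIC B).
congr (_ + _)%E.
exact: etrans (diff0 _ _ mA mB AB) (esym (diff0 _ _ mB mA BA)).
Qed.

Lemma measurable_preimage (d d' : measure_display) (T : measurableType d)
    (U : measurableType d') (Z : T -> U) (A : set U) :
  measurable_fun [set: T] Z -> measurable A -> measurable (Z @^-1` A).
Proof. by move=> mZ mA; rewrite -[Z @^-1` A]setTI; exact: mZ. Qed.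

(** The preimages of the complement of [A] under [X] and [Y] have the same probability, so one is
    null when the other is. *)
Lemma eq_in_law_ae (d d' : measure_display) (T : measurableType d)
    (U : measurableType d') (R : realType) (P : probability T R)
    (X Y : T -> U) (A : set U) :
  eq_in_law P X Y -> measurable A ->
  {ae P, forall w, A (X w)} -> {ae P, forall w, A (Y w)}.
Proof.
move=> [mX mY XY] mA AX.
have mCA : measurable (~` A) by exact: measurableC.
apply/(negligibleP P (measurable_preimage mY mCA)).
apply: etrans (esym (XY _ mCA)) _.
exact/(negligibleP P (measurable_preimage mX mCA)).
Qed.

Lemma unique_minimizer_opp (E : zmodType) (R : realType) (h k : E -> \bar R)
    (u : E) :
  (forall v, h v = k (- v)) -> unique_minimizer h u ->
  unique_minimizer k (- u).
Proof.
move=> hk [hmin huniq]; split=> [v|u' kmin].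
  by rewrite -hk; apply: le_trans (hmin (- v)) _; rewrite hk opprK.
rewrite -[u']opprK; congr (- _); apply: huniq => v.
by rewrite !hk opprK.
Qed.

(** Evenness of [D] is available on [Theta] only. Off [Theta], symmetry puts [- u] outside as well,
    and both sides are [+oo]. *)
Lemma criterion_opp (E : zmodType) (R : realType) (Theta : set E) (D : E -> R)
    (X : E -> \bar R) (f : E -> R) (u : E) :
  (forall u, Theta u -> Theta (- u)) ->
  (forall u, Theta u -> D (- u) = D u) ->
  (forall u, Theta u -> X u = 0%E) ->
  (forall u, ~ Theta u -> X u = +oo%E) ->
  criterion D X (fun v => f (- v)) u = criterion D X f (- u).
Proof.
move=> Theta_sym D_even X_in X_out; rewrite /criterion.
have [uT|uT] := pselect (Theta u).
  by rewrite D_even// !X_in//; exact: Theta_sym.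
by rewrite !X_out// => /Theta_sym; rewrite opprK.
Qed.

Theorem theorem3p2 (R : realType) (d : measure_display)
    (T : measurableType d) (P : probability T R)
    (Omega : lmodType R) (G : set (set Omega))
    (Theta : set Omega) (D : Omega -> R) (X : Omega -> \bar R)
    (F : set (set (Omega -> R))) (S : T -> g_sigma_algebraType F)
    (C : set (g_sigma_algebraType F)) (W : T -> generated_space G)
    (Omega_ls : location_scale_invariant G)
    (Theta_sym : forall u, Theta u -> Theta (- u))
    (D_even : forall u, Theta u -> D (- u) = D u)
    (X_in : forall u, Theta u -> X u = 0%E)
    (X_out : forall u, ~ Theta u -> X u = +oo%E)
    (F_eval : measurable_evaluations F)
    (S_meas : measurable_fun [set: T] S)
    (S_mean0 : mean_zero P S)
    (S_even : even_process P S)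
    (C_meas : measurable C)
    (S_in_C : {ae P, forall w, C (S w)})
    (argmin_meas : argmin_measurable_on G C D X)
    (W_meas : measurable_fun [set: T] W)
    (W_argmin : {ae P, forall w, unique_minimizer (criterion D X (S w)) (W w)}) :
  eq_in_law P W (fun w => (- (W w : Omega)) : generated_space G).
Proof.
have mWN : measurable_fun [set: T]
    (fun w => (- (W w : Omega)) : generated_space G).
  (* Negation is the change of scale -1 and location 0. *)
  rewrite (_ : (fun w => _) = (fun u : generated_space G =>
      (-1 *: (u : Omega) + 0) : generated_space G) \o W); last first.
    by apply/funext => w /=; rewrite scaleN1r addr0.
  exact: measurableT_comp (Omega_ls (-1) 0) W_meas.
split=> // A mA; have [_ mSN SSN] := S_even.
(* [C] may fail to be stable under reflection; the reflected process lies in it almost surely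
   because it has the law of [S]. *)
have SN_in_C := eq_in_law_ae S_even C_meas S_in_C.
(* [M] is the preimage of [A] under the argmin functional on [C]. *)
pose M := C `&` [set f : g_sigma_algebraType F |
  exists2 u, A u & unique_minimizer (criterion D X f) u].
have mM : measurable M by exact: argmin_meas.
have MP (V : T -> generated_space G) (Z : T -> g_sigma_algebraType F) :
    measurable_fun [set: T] V -> measurable_fun [set: T] Z ->
    {ae P, forall w, C (Z w)} ->
    {ae P, forall w, unique_minimizer (criterion D X (Z w)) (V w)} ->
    pushforward P V A = pushforward P Z M.
  move=> mV mZ CZ VZ; apply: (measure_ae_eq_set
    (measurable_preimage mV mA) (measurable_preimage mZ mM) (mu := P)).
  apply: filterS2 CZ VZ => w CZw VZw; split=> [AVw|[_ [u Au [umin _]]]].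
    by split=> //; exists (V w).
  (* Uniqueness identifies the minimizer [u] lying in [A] with [V w]. *)
  by move: Au; rewrite (VZw.2 u umin).
(* [MP] serves twice: for [W] with [S], then for [-W] with the reflected process; evenness of [S]
   links the two probabilities of [M]. *)
rewrite (MP W S)// SSN//; symmetry; apply: MP => //.
apply: filterS W_argmin => w; apply: unique_minimizer_opp => v.
by rewrite (criterion_opp _ _ Theta_sym D_even X_in X_out) opprK.
Qed.
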